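(* Let $M\in\mathbb{R}^{d\times d}$ be symmetric positive definite, let $S\in\mathbb{R}^{d\times d}$ be constant with $S^\top=-S$ or $S\preceq0$, let $V:\mathbb{R}^d\to\mathbb{R}$ be differentiable, and let $C>0$ satisfy $V(z)+C>0$ for all $z$. Let $h>0$, and let $(z^n,r^n)$, $(z^{n+1},r^{n+1})\in\mathbb{R}^d\times\mathbb{R}$ be related by one step of the SAV/CN scheme, with precomputed predictor $\hat z=\hat z^{\,n+\frac12}\in\mathbb{R}^d$: $$\frac{z^{n+1}-z^n}{h}=S\mu^{n+\frac12},\qquad \mu^{n+\frac12}=M\,\frac{z^{n+1}+z^n}{2}+\frac{r^{n+1}+r^n}{2\sqrt{V(\hat z)+C}}\nabla V(\hat z),$$ $$r^{n+1}-r^n=\frac{\nabla V(\hat z)^\top}{2\sqrt{V(\hat z)+C}}\,(z^{n+1}-z^n).$$ Write $\tilde z^k=[(z^k)^\top,r^k]^\top$ and $\tilde H(\tilde z)=\tilde H(z,r)=\tfrac12z^\top Mz+r^2-C$. Then $$\tilde H(z^{n+1},r^{n+1})-\tilde H(z^n,r^n)=h\Big[\nabla\tilde H\Big(\tfrac{\tilde z^n+\tilde z^{n+1}}2\Big)\Big]^\top\tilde S(\hat z)\,\nabla\tilde H\Big(\tfrac{\tilde z^n+\tilde z^{n+1}}2\Big)=h\,\big(\mu^{n+\frac12},S\mu^{n+\frac12}\big),$$ and the method is unconditionally energy-stable (for every $h>0$): $$\tilde H(z^{n+1},r^{n+1})=\tilde H(z^n,r^n)\ \text{ if } S^\top=-S,\qquad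 \tilde H(z^{n+1},r^{n+1})\le\tilde H(z^n,r^n)\ \text{ if } S\preceq0 .$$
   Context: $S\preceq0$ means that $\operatorname{sym}(S)=\tfrac12(S+S^\top)$ is negative semidefinite ($S$ need not be symmetric). $(\cdot,\cdot)$ is the Euclidean inner product, and $\nabla\tilde H$ is the gradient with respect to $(z,r)$. The structure matrix, which depends only on the $z$-component, is $$\tilde S(z)=\begin{bmatrix} S & \dfrac{S\nabla V(z)}{2\sqrt{V(z)+C}}\\[2mm] \dfrac{\nabla V(z)^\top S}{2\sqrt{V(z)+C}} & \dfrac{\nabla V(z)^\top S\nabla V(z)}{4(V(z)+C)}\end{bmatrix}.$$ The vector $\hat z^{\,n+\frac12}$ is an input to the step, computed beforehand; in practice it is a locally second-order approximation of the solution at $t_n+h/2$, for instance given by $\frac{\hat z-z^n}{h/2}=S(M\hat z+\nabla V(z^n))$. *)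

(* Defs.v *)
(* MathComp / MathComp-Analysis; vectors of R^n are column vectors 'cV[R]_n. *)
From mathcomp Require Import all_boot all_order all_algebra.
From mathcomp Require Import all_classical all_reals all_analysis.

Set Implicit Arguments.
Unset Strict Implicit.
Unset Printing Implicit Defensive.

Import Order.TTheory GRing.Theory Num.Theory.
Import numFieldNormedType.Exports.

Local Open Scope ring_scope.

Section Definitions.
Context {R : realType}.

Definition dot n (u v : 'cV[R]_n) : R := \sum_(i < n) u i 0 * v i 0.

Definition quad n (A : 'M[R]_n) (x : 'cV[R]_n) : R := (x^T *m A *m x) 0 0.

Definition posdefmx n (A : 'M[R]_n) : Prop :=
  A^T = A /\ forall x : 'cV[R]_n, x != 0 -> 0 < quad A x.

Definition negsemidefmx n (A : 'M[R]_n) : Prop :=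
  A^T = A /\ forall x : 'cV[R]_n, quad A x <= 0.

Definition sym_part n (A : 'M[R]_n) : 'M[R]_n := 2^-1 *: (A + A^T).

(* [A] itself is not required to be symmetric. *)
Definition mx_le0 n (A : 'M[R]_n) : Prop := negsemidefmx (sym_part A).

Definition grad n (f : 'cV[R]_n -> R) (x : 'cV[R]_n) : 'cV[R]_n :=
  \col_(i < n) 'D_(delta_mx i 0) f x.

(* The vector of R^(d+1) obtained by stacking z above r. *)
Definition stack d (z : 'cV[R]_d) (r : R) : 'cV[R]_(d + 1) := col_mx z r%:M.

Definition sav_energy d (M : 'M[R]_d) (C : R) (z : 'cV[R]_d) (r : R) : R :=
  2^-1 * quad M z + r ^+ 2 - C.

(* The same energy as a function on R^(d+1), so that its gradient is the
   gradient with respect to (z, r). *)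
Definition sav_energy_stacked d (M : 'M[R]_d) (C : R) (w : 'cV[R]_(d + 1)) : R :=
  sav_energy M C (usubmx w) (dsubmx w 0 0).

Definition sav_structure d (S : 'M[R]_d) (V : 'cV[R]_d -> R) (C : R)
    (z : 'cV[R]_d) : 'M[R]_(d + 1) :=
  block_mx
    S
    ((2 * Num.sqrt (V z + C))^-1 *: (S *m grad V z))
    ((2 * Num.sqrt (V z + C))^-1 *: ((grad V z)^T *m S))
    ((4 * (V z + C))^-1 *: ((grad V z)^T *m S *m grad V z)).

End Definitions.

(* Main.v *)
Require Import Defs.
From mathcomp Require Import all_boot all_order all_algebra.
From mathcomp Require Import all_classical all_reals all_analysis.
From mathcomp Require Import ring.

Set Implicit Arguments.
Unset Strict Implicit.
Unset Printing Implicit Defensive.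

Import Order.TTheory GRing.Theory Num.Theory.
Import numFieldNormedType.Exports.
Local Open Scope ring_scope.

(** The energy is quadratic in [(z, r)], so its increment over a step equals
    the gradient at the midpoint paired with the increment of [(z, r)]
    ([sav_energy_increment]).  Two facts then reduce both sides of the identity
    to [h (mu, S mu)].

    Write [w] for the gradient of [V] at the predictor and
    [c = 1 / (2 sqrt (V + C))], and [m] for the midpoint of [z^n] and
    [z^(n+1)].  The structure matrix factors as
    [P S P^T], where [P] stacks the identity above [c w^T], and [P^T] maps the
    midpoint gradient [(M m, r^n + r^(n+1))] to [mu].  This gives the quadratic
    form ([quad_sav_structure]).  The scheme for [r] says that the increment of
    [(z, r)] is [P (z^(n+1) - z^n) = h P S mu], so that pairing it with the
    midpoint gradient gives [h (mu, S mu)] again.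

    Conservation and dissipation follow, since [(mu, S mu)] only sees the
    symmetric part of [S].  The gradient of the energy ([grad_sav_energy]) is
    read off from its expansion along lines, which is exact at second order. *)

(** * The Euclidean inner product *)

Section Dot.
Context {R : realType}.

Lemma dotE n (u v : 'cV[R]_n) : dot u v = (u^T *m v) 0 0.
Proof. by rewrite mxE; apply: eq_bigr => i _; rewrite mxE. Qed.

Lemma dotC n (u v : 'cV[R]_n) : dot u v = dot v u.
Proof. by apply: eq_bigr => i _; rewrite mulrC. Qed.

Lemma dotDr n (u v w : 'cV[R]_n) : dot u (v + w) = dot u v + dot u w.
Proof. by rewrite !dotE mulmxDr mxE. Qed.

Lemma dotZr n a (u v : 'cV[R]_n) : dot u (a *: v) = a * dot u v.
Proof. by rewrite !dotE -scalemxAr mxE. Qed.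

Lemma dotNr n (u v : 'cV[R]_n) : dot u (- v) = - dot u v.
Proof. by rewrite -scaleN1r dotZr mulN1r. Qed.

Lemma dotDl n (u v w : 'cV[R]_n) : dot (u + v) w = dot u w + dot v w.
Proof. by rewrite dotC dotDr !(dotC w). Qed.

Lemma dotZl n a (u v : 'cV[R]_n) : dot (a *: u) v = a * dot u v.
Proof. by rewrite dotC dotZr dotC. Qed.

Lemma dotNl n (u v : 'cV[R]_n) : dot (- u) v = - dot u v.
Proof. by rewrite dotC dotNr dotC. Qed.

Lemma dot_trmx m n (A : 'M[R]_(m, n)) (u : 'cV[R]_m) (v : 'cV[R]_n) :
  dot u (A *m v) = dot (A^T *m u) v.
Proof. by rewrite !dotE trmx_mul trmxK mulmxA. Qed.

Lemma dot_delta n (i : 'I_n) (u : 'cV[R]_n) : dot (delta_mx i 0) u = u i 0.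
Proof. by rewrite dotE trmx_delta -rowE mxE. Qed.

Lemma dot_stack d (w : 'cV[R]_(d + 1)) (z : 'cV[R]_d) (r : R) :
  dot w (stack z r) = dot (usubmx w) z + dsubmx w 0 0 * r.
Proof.
rewrite /dot big_split_ord /= big_ord1; congr (_ + _).
  by apply: eq_bigr => i _; rewrite col_mxEu mxE.
by rewrite col_mxEd !mxE mulr1n.
Qed.

Lemma quadE n (A : 'M[R]_n) (x : 'cV[R]_n) : quad A x = dot x (A *m x).
Proof. by rewrite dotE mulmxA. Qed.

Lemma quad_skew n (A : 'M[R]_n) (x : 'cV[R]_n) : A^T = - A -> quad A x = 0.
Proof.
move=> skA; have : quad A x = - quad A x.
  by rewrite quadE {1}dot_trmx skA mulNmx dotNl dotC.
by move/eqP; rewrite -addr_eq0 -mulr2n mulrn_eq0 /= => /eqP.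
Qed.

Lemma quad_sym_part n (A : 'M[R]_n) (x : 'cV[R]_n) :
  quad (sym_part A) x = quad A x.
Proof.
rewrite !quadE /sym_part -scalemxAl mulmxDl dotZr dotDr.
by rewrite (dot_trmx A^T) trmxK (dotC (A *m x)); field.
Qed.

Lemma quadD n (A : 'M[R]_n) (x y : 'cV[R]_n) : A^T = A ->
  quad A (x + y) = quad A x + 2 * dot y (A *m x) + quad A y.
Proof.
move=> symA; rewrite !quadE mulmxDr !dotDl !dotDr.
by rewrite (dot_trmx A x y) symA (dotC (A *m x) y); ring.
Qed.

Lemma quadZ n (A : 'M[R]_n) a (x : 'cV[R]_n) : quad A (a *: x) = a ^+ 2 * quad A x.
Proof. by rewrite !quadE -scalemxAr dotZl dotZr; ring. Qed.

End Dot.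

(** * The gradient of the energy *)

Section Gradient.
Context {R : realType}.

(** Along a line on which [f] is a quadratic polynomial, the directional
    derivative is the linear coefficient. *)
Lemma derive_quadratic n (f : 'cV[R]_n -> R) (a v : 'cV[R]_n) (l q : R) :
  (forall t, f (t *: v + a) = f a + t * l + t ^+ 2 * q) -> 'D_v f a = l.
Proof.
move=> fE; apply/cvg_lim; first exact: Rhausdorff.
have lin0 : ((l + t * q) @[t --> (0 : R)^'] --> l + 0 * q)%classic.
  apply: cvg_within_filter.
  exact: (cvgD (cvg_cst l) (cvgM cvg_id (cvg_cst q))).
rewrite mul0r addr0 in lin0.
apply: cvg_trans lin0; apply: near_eq_cvg.
near=> t.
have t0 : t != 0 by near: t; exact: nbhs_dnbhs_neq.
by rewrite /= fE /GRing.scale /=; field.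
Unshelve. all: by end_near. Qed.

Lemma grad_sav_energy d (M : 'M[R]_d) (C : R) (w : 'cV[R]_(d + 1)) :
  M^T = M ->
  grad (sav_energy_stacked M C) w
    = stack (M *m usubmx w) (2 * dsubmx w 0 0).
Proof.
move=> symM; apply/colP => i; rewrite mxE -dot_delta.
set v := delta_mx i 0.
(* The second-order coefficient is the energy of [v] with [C] dropped. *)
apply: (@derive_quadratic _ _ _ _ _
  (2^-1 * quad M (usubmx v) + dsubmx v 0 0 ^+ 2)) => t.
rewrite dot_stack /sav_energy_stacked /sav_energy.
rewrite [usubmx (_ + _)]linearP [dsubmx (_ + _)]linearP /= addrC.
rewrite [t *: _ + _]addrC quadD // quadZ dotZl !mxE.
by field.
Qed.

(** The midpoint rule is exact for the quadratic energy. *)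
Lemma sav_energy_increment d (M : 'M[R]_d) (C : R) (z z1 : 'cV[R]_d) (r r1 : R) :
  M^T = M ->
  sav_energy M C z1 r1 - sav_energy M C z r
    = dot (z1 - z) (M *m (2^-1 *: (z1 + z))) + (r1 - r) * (r1 + r).
Proof.
move=> symM; rewrite /sav_energy !quadE -scalemxAr dotZr mulmxDr.
rewrite dotDl !dotDr !dotNl (dot_trmx M z1 z) symM (dotC (M *m z1)).
by field.
Qed.

End Gradient.

(** * The structure matrix *)

Section Structure.
Context {R : realType}.

(** The structure matrix is the congruence transform of [S] by the matrix that
    stacks the identity above [c w^T], where [w] is the gradient of [V] and
    [c = 1 / (2 sqrt (V + C))]. *)
Lemma sav_structure_factor d (S : 'M[R]_d) (V : 'cV[R]_d -> R) (C : R)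
    (z : 'cV[R]_d) : 0 < V z + C ->
  let p := (2 * Num.sqrt (V z + C))^-1 *: grad V z in
  sav_structure S V C z = col_mx 1%:M p^T *m S *m (col_mx 1%:M p^T)^T.
Proof.
move=> VC p; rewrite tr_col_mx trmx1 trmxK !mul_col_mx mul1mx.
rewrite !mul_mx_row !mulmx1 -block_mxEv.
rewrite /sav_structure; congr block_mx.
- by rewrite -scalemxAr.
- by rewrite [p^T]linearZ /= -scalemxAl.
- rewrite -scalemxAr [p^T]linearZ /= -!scalemxAl scalerA -invfM.
  by congr (_^-1 *: _); rewrite -{1}(sqr_sqrtr (ltW VC)); ring.
Qed.

Lemma quad_sav_structure d (S : 'M[R]_d) (V : 'cV[R]_d -> R) (C : R)
    (z y : 'cV[R]_d) (k : R) : 0 < V z + C ->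
  quad (sav_structure S V C z) (stack y k)
    = quad S (y + (k / (2 * Num.sqrt (V z + C))) *: grad V z).
Proof.
move=> VC; rewrite sav_structure_factor // !quadE.
set P := col_mx _ _.
have PTg : P^T *m stack y k
    = y + (k / (2 * Num.sqrt (V z + C))) *: grad V z.
  rewrite /P /stack tr_col_mx trmx1 trmxK mul_row_col mul1mx.
  by rewrite mul_mx_scalar scalerA.
by rewrite -!mulmxA (dot_trmx P) PTg.
Qed.

End Structure.

Theorem proposition2 (R : realType) (d : nat) (M S : 'M[R]_d)
    (V : 'cV[R]_d -> R) (C h : R)
    (zn zn1 zhat mu : 'cV[R]_d) (rn rn1 : R)
    (hM : posdefmx M)
    (hS : S^T = - S \/ mx_le0 S)
    (hV : forall z : 'cV[R]_d, differentiable V z)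
    (hC : 0 < C)
    (hVC : forall z : 'cV[R]_d, 0 < V z + C)
    (hh : 0 < h)
    (hmu : mu = M *m (2^-1 *: (zn1 + zn))
                + ((rn1 + rn) / (2 * Num.sqrt (V zhat + C))) *: grad V zhat)
    (hz : h^-1 *: (zn1 - zn) = S *m mu)
    (hr : rn1 - rn
          = (((2 * Num.sqrt (V zhat + C))^-1 *: (grad V zhat)^T)
             *m (zn1 - zn)) 0 0) :
  let g := grad (sav_energy_stacked M C)
                (2^-1 *: (stack zn rn + stack zn1 rn1)) in
  [/\ sav_energy M C zn1 rn1 - sav_energy M C zn rn
        = h * (g^T *m sav_structure S V C zhat *m g) 0 0,
      h * (g^T *m sav_structure S V C zhat *m g) 0 0 = h * dot mu (S *m mu),
      (S^T = - S -> sav_energy M C zn1 rn1 = sav_energy M C zn rn) &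
      (mx_le0 S -> sav_energy M C zn1 rn1 <= sav_energy M C zn rn)].
Proof.
have symM : M^T = M by case: hM.
have h0 : h != 0 by rewrite gt_eqF.
move=> g.
have gE : g = stack (M *m (2^-1 *: (zn1 + zn))) (rn1 + rn).
  rewrite /g grad_sav_energy // /stack add_col_mx scale_col_mx.
  rewrite col_mxKu col_mxKd (addrC zn); congr (col_mx _ _%:M).
  by rewrite !mxE /= !mulr1n; field.
have formE : (g^T *m sav_structure S V C zhat *m g) 0 0 = dot mu (S *m mu).
  have -> : (g^T *m sav_structure S V C zhat *m g) 0 0
      = quad (sav_structure S V C zhat) g by [].
  by rewrite gE quad_sav_structure // -hmu quadE.
have incE : sav_energy M C zn1 rn1 - sav_energy M C zn rn
    = h * dot mu (S *m mu).
  rewrite sav_energy_increment // -hz dotZr mulVKf // dotC.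
  by rewrite hr -scalemxAl mxE -dotE hmu dotDl dotZl; ring.
split.
- by rewrite formE.
- by rewrite formE.
- by move=> skS; apply/eqP; rewrite -subr_eq0 incE -quadE quad_skew // mulr0.
- move=> [_ leS]; rewrite -subr_le0 incE -quadE -quad_sym_part.
  by rewrite pmulr_rle0.
Qed.
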